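(* Let $\mathcal{A}$ be a Boolean algebra and let $\mathcal{M} \subseteq \mathcal{A}$ be a monotone class. Let $\mathcal{A}_0 \subseteq \mathcal{M}$ be a subalgebra of $\mathcal{A}$, and define $\sigma(\mathcal{A}_0) \subseteq \mathcal{M}$ to be the smallest monotone class in $\mathcal{A}$ that contains $\mathcal{A}_0$. Then $\sigma(\mathcal{A}_0)$ is also the smallest countably complete subalgebra of $\mathcal{A}$ that contains $\mathcal{A}_0$.
   Context: The Boolean algebra $\mathcal{A}$ is not assumed to be countably complete. A subset $\mathcal{M}$ of a Boolean algebra $\mathcal{A}$ is a monotone class (in $\mathcal{A}$) if: (1) for any non-decreasing sequence $p_1 \leq p_2 \leq \ldots$ in $\mathcal{M}$ there is an upper bound of the sequence in $\mathcal{M}$ that is less than any other upper bound of the sequence in $\mathcal{A}$ (i.e. the sequence has a least upper bound in $\mathcal{A}$ and it lies in $\mathcal{M}$); and (2) for any non-increasing sequence $p_1 \geq p_2 \geq \ldots$ in $\mathcal{M}$ there is a lower bound of the sequence in $\mathcal{M}$ that is greater than any other lower bound of the sequence in $\mathcal{A}$. A subalgebra $\mathcal{B} \subseteq \mathcal{A}$ is called countably complete if every countable subset $\{p_k\}_{k=1}^\infty$ of $\mathcal{B}$ has an upper bound in $\mathcal{B}$ that is less than any other upper bound of this subset in $\mathcal{A}$ (i.e. it has a least upper bound in $\mathcal{A}$, and this lies in $\mathcal{B}$). ''Smallest'' is with respect to inclusion. *)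

(* Defs.v *)
From mathcomp Require Import all_boot all_order.
From mathcomp Require Import boolp classical_sets.

Set Implicit Arguments.
Unset Strict Implicit.
Unset Printing Implicit Defensive.

Local Open Scope classical_set_scope.

Section BooleanAlgebra.
Context {d : Order.disp_t} {A : ctbDistrLatticeType d}.

Definition subalgebra (B : set A) : Prop :=
  [/\ B \bot%O, B \top%O,
      forall x y, B x -> B y -> B (Order.meet x y),
      forall x y, B x -> B y -> B (Order.join x y) &
      forall x, B x -> B (Order.compl x)].

(* Suprema and infima are always taken in the ambient algebra A; A itself is
   not assumed to be countably complete. *)
Definition monotone_class (M : set A) : Prop :=
  (forall p : nat -> A, (forall n, M (p n)) ->
     (forall n, (p n <= p n.+1)%O) ->
     exists2 q, M q & supremums (range p) q) /\
  (forall p : nat -> A, (forall n, M (p n)) ->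
     (forall n, (p n.+1 <= p n)%O) ->
     exists2 q, M q & infimums (range p) q).

Definition countably_complete_subalgebra (B : set A) : Prop :=
  subalgebra B /\
  forall p : nat -> A, (forall n, B (p n)) ->
    exists2 q, B q & supremums (range p) q.

(* The intersection of all monotone classes containing A0; it is itself a
   monotone class only if A0 is contained in at least one of them. *)
Definition sigma (A0 : set A) : set A := smallest monotone_class A0.

End BooleanAlgebra.

Definition is_smallest {T : Type} (C : set T -> Prop) (G S : set T) : Prop :=
  [/\ C S, G `<=` S & forall X, C X -> G `<=` X -> S `<=` X].

(* Main.v *)
Require Import Defs.
From mathcomp Require Import all_boot all_order.
From mathcomp Require Import boolp classical_sets.
Import Order.Theory.
Local Open Scope classical_set_scope.

(** A subalgebra is countably complete exactly when it is a monotone class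
    ([subalgebra_monotone_classP]): the supremum of a sequence is that of its
    increasing partial joins, and infima come from suprema by complementation.
    So it suffices to know that [sigma A0] is a subalgebra: every countably
    complete subalgebra above [A0] is then a monotone class, hence contains
    [sigma A0].

    That [sigma A0] is closed under the Boolean operations is the usual
    monotone class argument. If [f] commutes with limits of monotone sequences
    and sends [A0] into [sigma A0], then the elements of [sigma A0] that [f]
    sends into [sigma A0] form a monotone class containing [A0], so they are
    all of [sigma A0] ([sigma_stable]). Complementation is such an [f] by De
    Morgan. Meeting with a fixed [x] is one by the infinite distributive law
    [meet_supremum], valid in any Boolean algebra; the argument is run with [x]
    in [A0] and then, by symmetry of meet, with [x] in [sigma A0].

    As [A] need not be complete, limits are only guaranteed inside monotone classes;
    the intersection defining [sigma A0] is a monotone class because limits are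
    computed in [A] and are therefore the same for all of them. *)

Section MonotoneClasses.
Context {d : Order.disp_t} {A : ctbDistrLatticeType d}.
Implicit Types (p : nat -> A) (q x y : A) (B M : set A).

Lemma supremums_rangeP p q :
  supremums (range p) q <->
  (forall n, (p n <= q)%O) /\ (forall u, (forall n, (p n <= u)%O) -> (q <= u)%O).
Proof.
split=> [[ub lub]|[ub lub]]; split.
- by move=> n; apply: ub; exists n.
- by move=> u pu; apply: lub => _ [n _ <-].
- by move=> _ [n _ <-].
- by move=> u pu; apply: lub => n; apply: pu; exists n.
Qed.

Lemma infimums_rangeP p q :
  infimums (range p) q <->
  (forall n, (q <= p n)%O) /\ (forall l, (forall n, (l <= p n)%O) -> (l <= q)%O).
Proof.
split=> [[lb glb]|[lb glb]]; split.
- by move=> n; apply: lb; exists n.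
- by move=> l lp; apply: glb => _ [n _ <-].
- by move=> _ [n _ <-].
- by move=> l lp; apply: glb => n; apply: lp; exists n.
Qed.

Lemma supremums_compl p q :
  supremums (range p) q <-> infimums (range (fun n => ~` p n)%O) (~` q)%O.
Proof.
rewrite supremums_rangeP infimums_rangeP.
split=> -[bd opt]; split=> [n|u hu].
- by rewrite leC.
- by rewrite lexC; apply: opt => n; rewrite lexC.
- by rewrite -leC.
- by rewrite -leC; apply: opt => n; rewrite leC.
Qed.

Lemma infimums_compl p q :
  infimums (range p) q <-> supremums (range (fun n => ~` p n)%O) (~` q)%O.
Proof.
rewrite supremums_compl complK.
by rewrite (_ : (fun n => ~` ~` p n)%O = p) //; apply/funext => n; rewrite complK.
Qed.

(** Meeting with [x] is left adjoint to [fun u => ~` x `|` u], hence it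
    preserves every supremum that exists. *)
Lemma meet_supremum x p q : supremums (range p) q ->
  supremums (range (fun n => x `&` p n)%O) (x `&` q)%O.
Proof.
have adj y u : (x `&` y <= u)%O = (y <= ~` x `|` u)%O.
  by rewrite -leBLR diffE complK meetC.
move=> /supremums_rangeP[ub lub]; apply/supremums_rangeP; split=> [n|u pu].
  exact: leI2.
by rewrite adj; apply: lub => n; rewrite -adj.
Qed.

Lemma meet_infimum x p q : infimums (range p) q ->
  infimums (range (fun n => x `&` p n)%O) (x `&` q)%O.
Proof.
move=> /infimums_rangeP[lb glb]; apply/infimums_rangeP; split=> [n|l lp].
  exact: leI2.
rewrite lexI; apply/andP; split; first exact: le_trans (lp 0) (leIl _ _).
by apply: glb => n; apply: le_trans (lp n) (leIr _ _).
Qed.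

(** Treating both kinds of monotone sequence as one notion of limit lets
    order-reversing maps such as complementation be handled on the same footing
    as order-preserving ones. *)
Definition monotone_limit p q :=
  ((forall n, (p n <= p n.+1)%O) /\ supremums (range p) q) \/
  ((forall n, (p n.+1 <= p n)%O) /\ infimums (range p) q).

Definition limit_preserving (f : A -> A) :=
  forall p q, monotone_limit p q -> monotone_limit (f \o p) (f q).

Lemma compl_limit_preserving : limit_preserving Order.compl.
Proof.
move=> p q [[incr sup]|[decr inf]]; [right|left]; split.
- by move=> n; rewrite /= leC.
- exact/supremums_compl.
- by move=> n; rewrite /= leC.
- exact/infimums_compl.
Qed.

Lemma meet_limit_preserving x : limit_preserving (Order.meet x).
Proof.
move=> p q [[incr sup]|[decr inf]]; [left|right]; split.
- by move=> n; apply: leI2.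
- exact: meet_supremum.
- by move=> n; apply: leI2.
- exact: meet_infimum.
Qed.

(** The definition only provides some limit in [M]; this is enough
    because limits in [A] are unique. *)
Lemma monotone_class_limit M p q : monotone_class M ->
  (forall n, M (p n)) -> monotone_limit p q -> M q.
Proof.
move=> [supM infM] Mp [[incr sup]|[decr inf]].
- by have [r Mr supr] := supM p Mp incr; rewrite (is_subset1_supremums sup supr).
- by have [r Mr infr] := infM p Mp decr; rewrite (is_subset1_infimums inf infr).
Qed.

(** Inside a monotone class existence of limits is already granted, so only
    stability under limits has to be checked. *)
Lemma sub_monotone_class M B : monotone_class M -> B `<=` M ->
  (forall p q, (forall n, B (p n)) -> monotone_limit p q -> B q) ->
  monotone_class B.
Proof.
move=> [supM infM] BM limB; split=> p Bp mono.
- have [q _ sup] := supM p (fun n => BM _ (Bp n)) mono.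
  by exists q => //; apply: (limB p) => //; left.
- have [q _ inf] := infM p (fun n => BM _ (Bp n)) mono.
  by exists q => //; apply: (limB p) => //; right.
Qed.

Lemma monotone_class_sigma M B : monotone_class M -> B `<=` M ->
  monotone_class (sigma B).
Proof.
move=> mM BM; apply: (sub_monotone_class M) => //; first exact: smallest_sub.
move=> p q sp lim X [mX BX]; apply: (monotone_class_limit X p) => // n.
exact: (sp n X).
Qed.

Lemma sigma_stable B (f : A -> A) : monotone_class (sigma B) ->
  limit_preserving f -> (forall x, B x -> sigma B (f x)) ->
  forall x, sigma B x -> sigma B (f x).
Proof.
move=> mS lpf Bf.
suff sub : sigma B `<=` [set x | sigma B x /\ sigma B (f x)].
  by move=> x /sub[].
apply: smallest_sub; last first.
  by move=> x Bx; split; [exact: sub_gen_smallest|exact: Bf].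
apply: (sub_monotone_class (sigma B)) => // [x []//|p q Sp lim]; split.
- by apply: (monotone_class_limit _ p) => // n; case: (Sp n).
- by apply: (monotone_class_limit _ (f \o p)) (lpf _ _ lim) => // n; case: (Sp n).
Qed.

Lemma subalgebra_sigma B : subalgebra B -> monotone_class (sigma B) ->
  subalgebra (sigma B).
Proof.
move=> [B0 B1 BI _ BC] mS.
have BS : B `<=` sigma B by exact: sub_gen_smallest.
have SC : forall x, sigma B x -> sigma B (~` x)%O.
  apply: sigma_stable => // [|x Bx]; first exact: compl_limit_preserving.
  exact: BS (BC _ Bx).
have BSI x y : B x -> sigma B y -> sigma B (x `&` y)%O.
  move=> Bx; apply: sigma_stable => // [|z Bz].
    exact: meet_limit_preserving.
  exact: BS (BI _ _ Bx Bz).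
have SI x y : sigma B x -> sigma B y -> sigma B (x `&` y)%O.
  move=> Sx; apply: sigma_stable => // [|z Bz].
    exact: meet_limit_preserving.
  by rewrite meetC; apply: BSI.
split=> //; [exact: BS|exact: BS|move=> x y Sx Sy].
rewrite -[(x `|` y)%O]complK complU.
exact: SC (SI _ _ (SC _ Sx) (SC _ Sy)).
Qed.

Lemma supremums_partial_joins p q :
  supremums (range (fun n => \join_(i < n.+1) p i)%O) q ->
  supremums (range p) q.
Proof.
move=> /supremums_rangeP[ub lub]; apply/supremums_rangeP; split=> [n|u pu].
  by apply: le_trans (ub n); rewrite big_ord_recr leUr.
by apply: lub => n; apply/joinsP => i _.
Qed.

Lemma subalgebra_monotone_classP B : subalgebra B ->
  monotone_class B <-> countably_complete_subalgebra B.
Proof.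
move=> sB; have [B0 _ _ BU BC] := sB.
split=> [[supB _]|[_ supB]].
- split=> // p Bp.
  have [n|n|q Bq sup] := supB (fun n => \join_(i < n.+1) p i)%O.
  + by apply: big_ind => // i _; apply: Bp.
  + by rewrite [leRHS]big_ord_recr leUl.
  + by exists q => //; apply: supremums_partial_joins.
- split=> p Bp _; first exact: supB.
  have [q Bq sup] := supB (fun n => ~` p n)%O (fun n => BC _ (Bp n)).
  exists (~` q)%O; first exact: BC.
  by apply/infimums_compl; rewrite complK.
Qed.

End MonotoneClasses.

Theorem theorem8 (d : Order.disp_t) (A : ctbDistrLatticeType d)
    (M A0 : set A) (hM : monotone_class M)
    (hA0 : subalgebra A0) (hA0M : A0 `<=` M) :
  [/\ is_smallest monotone_class A0 (sigma A0),
      sigma A0 `<=` M &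
      is_smallest countably_complete_subalgebra A0 (sigma A0)].
Proof.
have mS : monotone_class (sigma A0) by exact: monotone_class_sigma hM hA0M.
have sub : A0 `<=` sigma A0 by exact: sub_gen_smallest.
have least X : monotone_class X -> A0 `<=` X -> sigma A0 `<=` X.
  exact: smallest_sub.
split; [by split|exact: least|split=> //].
- by apply/subalgebra_monotone_classP => //; apply: subalgebra_sigma.
- move=> X ccX; apply: least.
  by apply/subalgebra_monotone_classP => //; case: ccX.
Qed.
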